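(* For every nonincreasing locally integrable function $f$ on $\mathbb{R}_+=(0,\infty)$, $$\alpha_0\Vert f\Vert_{\mathrm{BMO}}\leq \Vert Hf\Vert_{\mathrm{BMO}}\leq \Vert f\Vert_{\mathrm{BMO}}.$$ Moreover, the constants $\alpha_0$ and $1$ are optimal: the left inequality fails in general if $\alpha_0$ is replaced by a larger constant, and the right inequality fails in general if the constant $1$ in front of $\Vert f\Vert_{\mathrm{BMO}}$ is replaced by a smaller constant.
   Context: $\mathbb{R}_+=(0,\infty)$. Functions are real valued, and ''locally integrable on $\mathbb{R}_+$'' means integrable on every bounded interval $I\subset\mathbb{R}_+$, including the intervals $(0,t)$, $t>0$. The Hardy operator is $Hf(x)=\frac1x\int_0^x f(t)\,dt$, $x>0$. For a bounded interval $I\subset\mathbb{R}_+$, $f_I=\frac1{|I|}\int_I f$, $\Omega(f;I)=\frac1{|I|}\int_I|f(x)-f_I|\,dx$, and $\Vert f\Vert_{\mathrm{BMO}}=\sup_{I\subset\mathbb{R}_+}\Omega(f;I)\in[0,\infty]$, the supremum being over all bounded intervals $I\subset\mathbb{R}_+$; if a function fails to be integrable on some bounded interval $I\subset\mathbb{R}_+$, its BMO seminorm is understood to be $+\infty$. The constant is $\alpha_0=\dfrac{4\log\gamma_1}{\gamma_1(1+\log\gamma_1)}$, where $\gamma_1>1$ is the (unique) solution in $(1,\infty)$ of $\log\!\left(\frac{\gamma}{1+\log\gamma}\right)=\frac{\log\gamma}{1+\log\gamma}$; numerically $\gamma_1\approx4.648717541$, $\alpha_0\approx0.52123637$. *)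

(* Defs.v *)
From mathcomp Require Import all_boot all_order all_algebra.
From mathcomp Require Import all_classical all_reals all_analysis.
From mathcomp Require Import ring lra.
Import Order.TTheory GRing.Theory Num.Theory.
Import numFieldNormedType.Exports.

Set Implicit Arguments.
Unset Strict Implicit.
Unset Printing Implicit Defensive.

Local Open Scope classical_set_scope.
Local Open Scope ring_scope.

(* A function on (0, +oo) is represented by a total function R -> R;
   no definition below looks at its values outside `]0, +oo[. *)

Section bmo.
Context {R : realType}.
Implicit Types (I : set R) (f : R -> R).

Local Notation mu := (@lebesgue_measure R).

(* The bounded intervals of (0, +oo), with or without their endpoints.
   A left endpoint equal to 0 is allowed; empty sets and singletons are not. *)
Definition bounded_itv I : Prop :=
  [/\ is_interval I, bounded_set I, I `<=` `]0, +oo[ & (0 < mu I)%E].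

(* Stronger than mathcomp-analysis's [locally_integrable], which is about
   compact sets: here the integral must converge at 0 as well. *)
Definition loc_integrable f : Prop :=
  forall I, bounded_itv I -> mu.-integrable I (EFin \o f).

Definition mean f I : R := (fine (mu I))^-1 * \int[mu]_(x in I) f x.

Definition oscillation f I : \bar R :=
  ((fine (mu I))^-1%:E * \int[mu]_(x in I) `|f x - mean f I|%:E)%E.

Definition bmo f : \bar R :=
  if `[< loc_integrable f >] then ereal_sup (oscillation f @` bounded_itv)
  else +oo%E.

Definition Hardy f : R -> R := fun x => x^-1 * \int[mu]_(t in `]0, x[) f t.

End bmo.

Definition gamma1_eq {R : realType} (g : R) : Prop :=
  1 < g /\ ln (g / (1 + ln g)) = ln g / (1 + ln g).

Definition gamma1 {R : realType} : R := get gamma1_eq.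

Definition alpha0 {R : realType} : R :=
  4 * ln gamma1 / (gamma1 * (1 + ln gamma1)).

(* With u = 1 + ln g, the equation for gamma1 reads gamma1_aux u = 0. *)
Definition gamma1_aux {R : realType} (u : R) : R := u - 2 + u^-1 - ln u.

Lemma gamma1_eqE {R : realType} (g : R) :
  gamma1_eq g <-> 1 < g /\ gamma1_aux (1 + ln g) = 0.
Proof.
rewrite /gamma1_eq /gamma1_aux; split=> -[g1]; have lg := ln_gt0 g1;
  have u0 : 0 < 1 + ln g by lra.
- rewrite ln_div ?posrE//; last by lra.
  move=> e; split => //.
  have -> : (1 + ln g)^-1 = 1 - ln g / (1 + ln g) by field; lra.
  lra.
- move=> e; split => //; rewrite ln_div ?posrE//; last by lra.
  have -> : ln g / (1 + ln g) = 1 - (1 + ln g)^-1 by field; lra.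
  lra.
Qed.

Lemma is_derive_gamma1_aux {R : realType} (u : R) : 0 < u ->
  is_derive u 1 gamma1_aux (1 - u^-2 - u^-1).
Proof.
move=> u0.
have u0' : u != 0 by rewrite gt_eqF.
have dl := is_derive1_ln u0.
have dv : is_derive u 1 (fun y : R => y^-1) (- u^-2).
  have := @is_deriveV R id u 1 1 u0' (is_derive_id _ _).
  by rewrite -[_ *: _]/(_ * _) mulr1.
have d := is_deriveB (is_deriveD (is_deriveB (is_derive_id u (1:R))
  (is_derive_cst (2:R) u 1)) dv) dl.
by apply: (is_derive_eq d); rewrite subr0.
Qed.

Lemma gamma1_aux1 {R : realType} : gamma1_aux (1 : R) = 0.
Proof. by rewrite /gamma1_aux ln1 invr1; lra. Qed.

Lemma gamma1_aux_Rolle {R : realType} (a b : R) : 1 <= a -> a < b ->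
  gamma1_aux a = 0 -> gamma1_aux b = 0 ->
  exists2 c, a < c < b & c ^+ 2 - c - 1 = 0.
Proof.
move=> a1 ab fa fb.
have der x : a <= x -> is_derive x 1 gamma1_aux (1 - x^-2 - x^-1).
  by move=> ax; apply: is_derive_gamma1_aux; lra.
have [|||c cab dc] := @Rolle R gamma1_aux a b ab.
- move=> x; rewrite in_itv/= => /andP[/ltW ax _].
  by have [] := der x ax.
- apply: derivable_within_continuous => x; rewrite in_itv/= => /andP[ax _].
  by have [] := der x ax.
- by rewrite fa fb.
exists c; first by move: cab; rewrite in_itv.
move: cab; rewrite in_itv/= => /andP[/ltW ac _].
have [_ e1] := der c ac; have [_ e2] := dc; move: e2; rewrite e1.
have c0 : c != 0 by rewrite gt_eqF//; lra.
move=> e; have -> : c ^+ 2 - c - 1 = c ^+ 2 * (1 - c^-2 - c^-1).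
  by field.
by rewrite e mulr0.
Qed.

Lemma gamma1_eq_uniq {R : realType} (g h : R) :
  gamma1_eq g -> gamma1_eq h -> g = h.
Proof.
wlog gh : g h / g < h.
  move=> W Hg Hh; have [lt|lt|//] := ltgtP g h; first exact: W.
  by apply/esym; exact: W.
move=> /gamma1_eqE[g1 eg] /gamma1_eqE[h1 eh].
have lg := ln_gt0 g1.
have lgh : ln g < ln h by rewrite ltr_ln ?posrE; lra.
have [||||c /andP[c1 cg] ec] := @gamma1_aux_Rolle R 1 (1 + ln g).
- by [].
- lra.
- exact: gamma1_aux1.
- by [].
have [||||d /andP[d1 dg] ed] := @gamma1_aux_Rolle R (1 + ln g) (1 + ln h).
- lra.
- lra.
- by [].
- by [].
nra.
Qed.

Lemma gamma1_eq_ex {R : realType} : exists g : R, gamma1_eq g.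
Proof.
have l2 : 1 / 2 <= ln (2 : R).
  have := @le_ln1Dx R (- 2^-1).
  have -> : 1 + - 2^-1 = 2^-1 :> R by field.
  rewrite lnV ?posrE//; lra.
have l4 : ln (4 : R) < 9 / 4.
  have -> : (4 : R) = 2 * 2 by ring.
  have := @le_ln1Dx R 1 ; rewrite lnM ?posrE//; lra.
have [|||u /[!in_itv]/= /andP[u2 u4] eu] := @IVT R gamma1_aux 2 4 0.
- lra.
- apply: derivable_within_continuous => x; rewrite in_itv/= => /andP[ax _].
  by have [] := @is_derive_gamma1_aux R x ltac:(lra).
- rewrite /gamma1_aux; apply/andP; split.
    rewrite ge_min; apply/orP; left; lra.
  rewrite le_max; apply/orP; right; lra.
exists (expR (u - 1)); apply/gamma1_eqE; split.
  by rewrite expR_gt1; lra.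
by rewrite expRK addrC subrK.
Qed.

Lemma gamma1P {R : realType} : gamma1_eq (gamma1 : R).
Proof. by have [g Hg] := @gamma1_eq_ex R; exact: (@getI _ _ g). Qed.

(* Main.v *)
Require Import Defs.
From mathcomp Require Import all_boot all_order all_algebra.
From mathcomp Require Import all_classical all_reals all_analysis.
From mathcomp Require Import measurable_realfun.
From mathcomp Require Import ring lra.
Import Order.TTheory GRing.Theory Num.Theory.
Import numFieldNormedType.Exports.

Set Implicit Arguments.
Unset Strict Implicit.
Unset Printing Implicit Defensive.

Local Open Scope classical_set_scope.
Local Open Scope ring_scope.

(** Write F = Hf and G = HF, let P be the primitive of f vanishing at 0, so
    that F(x) = P(x) / x, and let Q be the primitive of F. Since f is
    nonincreasing, P is concave, and F is nonincreasing too.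

    The mean oscillation of f on (0, t) is the supremum over c of 2 (c / t)
    (F(c) - F(t)), called [gap f c t] below: the two halves of the integral
    of |f - m| about the mean m are equal, and the half where f >= m is an
    initial segment (0, c). Enlarging an interval so that its left endpoint
    becomes 0 and its mean does not change cannot decrease the oscillation,
    so that the norm of f is the supremum of all gaps of f (lemmas
    [oscillation_le_gap] and [bmo_leP]). As F is again nonincreasing, the
    norm of F is the supremum of the gaps of F, and only gaps have to be
    compared.

    Upper bound. G(c) - G(t) is the average over s in (0, 1) of F(cs) -
    F(ts), and c / t is invariant under the dilation by s; hence a bound on
    the gaps of f passes to those of F ([gap_Hardy_le]). The same bound
    gives f <= F <= f + const, hence the integrability of F at 0
    ([Hardy_le_gap]). Equality holds for f = - ln, because then F = f + 1.

    Lower bound. Up to constants, a nonincreasing f is a mixture of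
    indicators of intervals (0, r). For one such indicator the gaps of F are
    largest, with value alpha0 / 2, at the points a = r g / (1 + ln g) and b
    = r g, where g is gamma1 ([gap_Hardy_step_le]); the equation of g says
    that this is where (ln t - ln (1 + ln t)) / t is maximal
    ([ln_ratio_le_alpha0]). For a general f and given c < t, the gap of F is
    tested at these points with r = t / 2. The function Q - P is convex in
    the variable ln x, so it lies above its tangent at t ([excess_tangent]);
    integrated against dx / x^2 over (a, b) and multiplied by 2a / b, this
    tangent yields, by the equation of g, alpha0 / t times (Q - P)(t) + (1 -
    ln 2) (P(t) - t f(t)). Finally concavity of P and the inequality ln z <=
    z - 1 at z = 2c / t show that the second factor is at least t times [gap
    f c t] ([excess_ge_gap]). The choice r = t / 2 is the right one because,
    among the nonincreasing f with values in [0, 1], the largest value of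
    [gap f c t] for given t is that of the indicator of (0, t / 2) at c = t
    / 2. *)

(** * Integrals over bounded intervals of the half-line *)

Section primitive.
Context {R : realType}.
Implicit Types (f h : R -> R) (I : set R) (a b c t x y : R).

Local Notation mu := (@lebesgue_measure R).

Definition primitive f x : R := \int[mu]_(t in `]0, x[) f t.

Lemma HardyE f x : Hardy f x = primitive f x / x.
Proof. by rewrite /Hardy mulrC. Qed.

Lemma measure_itv a b (b0 b1 : bool) : a <= b ->
  mu [set` Interval (BSide b0 a) (BSide b1 b)] = (b - a)%:E.
Proof.
rewrite le_eqVlt lebesgue_measure_itv/= lte_fin.
by move=> /predU1P[->|->//]; rewrite ltxx subrr.
Qed.

Lemma bounded_setoo a b : bounded_set `]a, b[%classic.
Proof.
exists (`|a| + `|b|); split; first exact: num_real.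
move=> M M1 x /=; rewrite in_itv/= => /andP[ax xb].
apply: ltW; apply: le_lt_trans M1; rewrite ler_norml.
have := ler_norm b; have := ler_norm (- a); rewrite normrN.
have := normr_ge0 a; have := normr_ge0 b; lra.
Qed.

Lemma bounded_set_bound I : bounded_set I ->
  exists M : R, forall x, I x -> `|x| <= M.
Proof.
move=> [M [_ bM]]; exists (M + 1) => x Ix.
by apply: (bM (M + 1) _ x Ix); rewrite ltrDl.
Qed.

Lemma bounded_itvoo a b : 0 <= a -> a < b -> bounded_itv `]a, b[.
Proof.
move=> a0 ab; split.
- exact: interval_is_interval.
- exact: bounded_setoo.
- by move=> x /=; rewrite !in_itv/= andbT => /andP[ax _]; lra.
- by rewrite measure_itv ?ltW// lte_fin subr_gt0.
Qed.

(** Positive measure forces distinct endpoints; a negative left endpoint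
    would leave room for a point of the interval outside the half-line. *)
Lemma bounded_itvP I : bounded_itv I ->
  exists a b (b0 b1 : bool),
    [/\ 0 <= a, a < b & I = [set` Interval (BSide b0 a) (BSide b1 b)]].
Proof.
move=> [/is_intervalP iI bI I0 mI].
have [l [u [b0 [b1 eI]]]] : exists l u (b0 b1 : bool),
    Rhull I = Interval (BSide b0 l) (BSide b1 u).
  have [M IM] := bounded_set_bound bI.
  have lI : has_lbound I by exists (- M) => x /IM; rewrite ler_norml => /andP[].
  have uI : has_ubound I by exists M => x /IM; rewrite ler_norml => /andP[].
  rewrite /Rhull (asboolT lI) (asboolT uI).
  by exists (inf I), (sup I), `[< I (inf I) >], (~~ `[< I (sup I) >]).
rewrite eI in iI.
have lu : l < u.
  move: mI; rewrite iI lebesgue_measure_itv/= lte_fin.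
  by case: ifP => //; rewrite ltxx.
exists l, u, b0, b1; split => //.
rewrite leNgt; apply/negP => l0.
pose x := (l + Order.min u 0) / 2.
have lx : l < x by rewrite /x; case: (leP u 0); lra.
have xu : x < u by rewrite /x; case: (leP u 0); lra.
have /I0 : I x.
  rewrite iI/= in_itv/=; apply/andP; split.
  - by case: (b0); rewrite ?lteifF ?lteifT// ltW.
  - by case: (b1); rewrite ?lteifF ?lteifT// ltW.
by rewrite /= in_itv/= andbT /x; case: (leP u 0); lra.
Qed.

Lemma Rintegral_cstoo a b k : a <= b ->
  \int[mu]_(x in `]a, b[) k = k * (b - a).
Proof.
by move=> ab; rewrite Rintegral_cst//= measure_itv. Qed.

Lemma integrable_cstoo a b k : mu.-integrable `]a, b[ (EFin \o cst k).
Proof.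
have [ab|ba] := ltP a b; last first.
  rewrite set_itv_ge ?bnd_simp -?leNgt//.
  exact: integrable_set0.
apply/integrableP; split; first exact/measurable_EFinP/measurable_cst.
by rewrite /= integral_cst//= measure_itv ?ltW// -EFinM ltry.
Qed.

Section integrable_on_bounded_intervals.
Variable f : R -> R.
Hypothesis fi : loc_integrable f.

Lemma loc_integrableoo a b : 0 <= a -> mu.-integrable `]a, b[ (EFin \o f).
Proof.
move=> a0; have [ab|ba] := ltP a b; first exact/fi/bounded_itvoo.
rewrite set_itv_ge ?bnd_simp -?leNgt//.
exact: integrable_set0.
Qed.

Lemma Rintegral_itvoo a b (b0 b1 : bool) : 0 <= a ->
  \int[mu]_(x in [set` Interval (BSide b0 a) (BSide b1 b)]) f x =
  \int[mu]_(x in `]a, b[) f x.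
Proof.
move=> a0; rewrite /Rintegral integral_itv_bndoo//.
exact: measurable_int (loc_integrableoo b a0).
Qed.

Lemma primitiveB a b : 0 <= a -> a <= b ->
  primitive f b - primitive f a = \int[mu]_(x in `]a, b[) f x.
Proof.
move=> a0 ab; have [->|nab] := eqVneq a b.
  by rewrite subrr set_itvoo0 Rintegral_set0.
have {}ab : a < b by rewrite lt_neqAle nab.
rewrite /primitive -(@Rintegral_itvoo 0 a false false)//.
by rewrite (@Rintegral_itvB _ _ (BRight 0) (BLeft b) a) ?bnd_simp//;
  exact: loc_integrableoo.
Qed.

Lemma loc_integrable_subr k : loc_integrable (fun x => f x - k).
Proof.
move=> I bI; have [a [b [b0 [b1 [a0 ab eI]]]]] := bounded_itvP bI.
have mI : measurable I by rewrite eI; exact: measurable_itv.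
rewrite (_ : EFin \o _ = (EFin \o f) \- (EFin \o cst k))%E//.
apply: integrableB => //; first exact: fi.
apply/integrableP; split; first exact/measurable_EFinP/measurable_cst.
by rewrite /= integral_cst//= eI measure_itv ?ltW// -EFinM ltry.
Qed.

Lemma loc_integrable_dist k : loc_integrable (fun x => `|f x - k|).
Proof. by move=> I bI; exact: integrable_norm (loc_integrable_subr k bI). Qed.

Lemma primitiveB_cst a b k : 0 <= a -> a <= b ->
  \int[mu]_(x in `]a, b[) (f x - k) =
  primitive f b - primitive f a - k * (b - a).
Proof.
move=> a0 ab; rewrite RintegralB//; last 2 first.
- exact: loc_integrableoo.
- exact: integrable_cstoo.
by rewrite primitiveB// Rintegral_cstoo.
Qed.

Lemma mean_itv a b (b0 b1 : bool) : 0 <= a -> a < b ->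
  mean f [set` Interval (BSide b0 a) (BSide b1 b)] =
  (primitive f b - primitive f a) / (b - a).
Proof.
move=> a0 ab; rewrite /mean measure_itv ?ltW//= Rintegral_itvoo//.
by rewrite -primitiveB ?(ltW ab)// mulrC.
Qed.

End integrable_on_bounded_intervals.

(** Reduces oscillations over all kinds of intervals to integrals over open
    intervals and to increments of the primitive. *)
Lemma oscillation_itv f a b (b0 b1 : bool) :
  loc_integrable f -> 0 <= a -> a < b ->
  oscillation f [set` Interval (BSide b0 a) (BSide b1 b)] =
  ((\int[mu]_(x in `]a, b[)
      `|f x - (primitive f b - primitive f a) / (b - a)|) / (b - a))%:E.
Proof.
move=> fi a0 ab; rewrite /oscillation mean_itv//.
set m := _ / _.
have mi := loc_integrableoo (loc_integrable_dist fi m) b a0.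
rewrite measure_itv ?ltW//= integral_itv_bndoo//; last first.
  exact: measurable_int mi.
rewrite muleC EFinM /Rintegral fineK//.
exact: integrable_fin_num mi.
Qed.

End primitive.

(** * Oscillation about the mean *)

Section monotone.
Context {R : realType}.
Implicit Types (f h : R -> R) (I : set R) (a b c t x y : R).

Local Notation mu := (@lebesgue_measure R).

(** Twice the mean over (0, t) of f - m, restricted to (0, c), where m is the
    mean of f on (0, t). *)
Definition gap f c t : R := 2 * (c / t) * (Hardy f c - Hardy f t).

(** The parts of the integral of f - m over (a, c) and (c, b) are opposite,
    and each is at most the integral of |f - m| over the same interval. *)
Lemma oscillation_ge f a b c m : loc_integrable f ->
  0 <= a -> a <= c -> c <= b ->
  m * (b - a) = primitive f b - primitive f a ->
  2 * (primitive f c - primitive f a - m * (c - a)) <=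
  \int[mu]_(x in `]a, b[) `|f x - m|.
Proof.
move=> fi a0 ac cb mE.
have di := loc_integrable_dist fi m.
have -> : \int[mu]_(x in `]a, b[) `|f x - m| =
    \int[mu]_(x in `]a, c[) `|f x - m| + \int[mu]_(x in `]c, b[) `|f x - m|.
  rewrite -!primitiveB//; lra.
have h1 : \int[mu]_(x in `]a, c[) (f x - m) <=
          \int[mu]_(x in `]a, c[) `|f x - m|.
  apply: le_Rintegral => //.
  - by have := loc_integrableoo (loc_integrable_subr fi m); apply.
  - by have := loc_integrableoo di; apply.
  - by move=> x _; exact: ler_norm.
have h2 : - (\int[mu]_(x in `]c, b[) (f x - m)) <=
          \int[mu]_(x in `]c, b[) `|f x - m|.
  apply: (le_trans (ler_norm _)); rewrite normrN.
  apply: le_normr_Rintegral => //.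
  by have := loc_integrableoo (loc_integrable_subr fi m); apply; lra.
rewrite !primitiveB_cst// in h1 h2; lra.
Qed.

(** When f crosses its mean at c, both inequalities behind [oscillation_ge]
    are equalities. *)
Lemma oscillation_crossing f a b c m : loc_integrable f ->
  0 <= a -> a <= c -> c <= b ->
  m * (b - a) = primitive f b - primitive f a ->
  (forall x, a < x -> x < c -> m <= f x) ->
  (forall x, c < x -> x < b -> f x <= m) ->
  \int[mu]_(x in `]a, b[) `|f x - m| =
  2 * (primitive f c - primitive f a - m * (c - a)).
Proof.
move=> fi a0 ac cb mE fm mf.
have di := loc_integrable_dist fi m.
have -> : \int[mu]_(x in `]a, b[) `|f x - m| =
    \int[mu]_(x in `]a, c[) `|f x - m| + \int[mu]_(x in `]c, b[) `|f x - m|.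
  rewrite -!primitiveB//; lra.
have -> : \int[mu]_(x in `]a, c[) `|f x - m| =
          \int[mu]_(x in `]a, c[) (f x - m).
  apply: eq_Rintegral => x; rewrite inE/= in_itv/= => /andP[ax xc].
  by rewrite ger0_norm// subr_ge0 fm.
have -> : \int[mu]_(x in `]c, b[) `|f x - m| =
          \int[mu]_(x in `]c, b[) (- 1 * (f x - m)).
  apply: eq_Rintegral => x; rewrite inE/= in_itv/= => /andP[ax xc].
  by rewrite ler0_norm ?mulN1r// subr_le0 mf.
rewrite RintegralZl//; last first.
  by have := loc_integrableoo (loc_integrable_subr fi m); apply; lra.
rewrite !primitiveB_cst//; lra.
Qed.

Section nonincreasing.
Variable f : R -> R.
Hypothesis fi : loc_integrable f.
Hypothesis fni : {in `]0, +oo[ &, nonincreasing_fun f}.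

Local Notation P := (primitive f).

Lemma nonincreasing_itvy x y : 0 < x -> x <= y -> f y <= f x.
Proof. by move=> x0 xy; apply: fni; rewrite ?in_itv/= ?andbT//; lra. Qed.

Lemma primitiveB_ge a b : 0 <= a -> a <= b -> (b - a) * f b <= P b - P a.
Proof.
move=> a0 ab; rewrite primitiveB// mulrC -Rintegral_cstoo//.
apply: le_Rintegral => //; [exact: integrable_cstoo|exact: loc_integrableoo|].
move=> x /=; rewrite in_itv/= => /andP[ax xb].
by apply: nonincreasing_itvy; lra.
Qed.

Lemma primitiveB_le a b : 0 < a -> a <= b -> P b - P a <= (b - a) * f a.
Proof.
move=> a0 ab; rewrite primitiveB ?(ltW a0)// mulrC -Rintegral_cstoo//.
apply: le_Rintegral => //.
- by have := loc_integrableoo fi; apply; exact: ltW.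
- exact: integrable_cstoo.
move=> x /=; rewrite in_itv/= => /andP[ax xb].
by apply: nonincreasing_itvy; lra.
Qed.

Lemma primitive0 : P 0 = 0.
Proof. by rewrite /primitive set_itvoo0 Rintegral_set0. Qed.

Lemma level_crossing a b m : 0 <= a -> a < b ->
  exists c, [/\ a <= c, c <= b,
    forall x, a < x -> x < c -> m <= f x &
    forall x, c < x -> x < b -> f x <= m].
Proof.
move=> a0 ab; pose S := [set x | x = a \/ [/\ a < x, x < b & m < f x]].
have Sa : S a by left.
have Sb : ubound S b by move=> x [->|[_ xb _]]; exact: ltW.
have supS : has_sup S by split; [exists a|exists b].
exists (sup S); split.
- exact: ub_le_sup supS.2 _ Sa.
- exact: ge_sup supS.1 Sb.
- move=> x ax xc; have [y Sy xy] := sup_gt supS.1 xc.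
  case: Sy => [ya|[_ yb my]]; first by move: xy; rewrite ya; lra.
  by apply: (le_trans (ltW my)); apply: nonincreasing_itvy; lra.
- move=> x cx xb; rewrite leNgt; apply/negP => mx.
  have : S x.
    right; split => //; apply: le_lt_trans cx; exact: ub_le_sup supS.2 _ Sa.
  by move=> /(ub_le_sup supS.2); rewrite leNgt cx.
Qed.

End nonincreasing.
End monotone.

(** * Oscillation of a nonincreasing function and dilation gaps *)

Section oscillation_and_gap.
Context {R : realType}.
Implicit Types (f h : R -> R) (I : set R) (a b c t x y : R).

Local Notation mu := (@lebesgue_measure R).

Variable f : R -> R.
Hypothesis fi : loc_integrable f.
Hypothesis fni : {in `]0, +oo[ &, nonincreasing_fun f}.

Local Notation P := (primitive f).

Lemma Hardy_ge x : 0 < x -> f x <= Hardy f x.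
Proof.
move=> x0; rewrite HardyE ler_pdivlMr// mulrC.
by have := primitiveB_ge fi fni (lexx 0) (ltW x0); rewrite primitive0 !subr0.
Qed.

Lemma Hardy_nincr a b : 0 < a -> a <= b -> Hardy f b <= Hardy f a.
Proof.
move=> a0 ab; have h := Hardy_ge a0.
have b0 : 0 < b by lra.
rewrite [leLHS]HardyE ler_pdivrMr//.
have := primitiveB_le fi fni a0 ab.
have -> : P a = Hardy f a * a by rewrite HardyE; field; lra.
nra.
Qed.

Lemma gap_ge0 c t : 0 < c -> c < t -> 0 <= gap f c t.
Proof.
move=> c0 ct; rewrite /gap mulr_ge0//.
  by rewrite mulr_ge0// divr_ge0//; lra.
by rewrite subr_ge0 Hardy_nincr// ltW.
Qed.

(** Let f cross its mean m at c, and let A and A1 be the means of f - m over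
    (0, c) and (a, c), B the mean of m - f over (c, b).  The oscillation on
    (a, b) is 2 / (1 / A1 + 1 / B).  Monotonicity gives A >= A1, and the mean
    of m - f over (c, t) is at least B for t >= b; the t for which the two
    halves about m would balance with A and B gives a gap at least
    2 / (1 / A + 1 / B). *)
Lemma oscillation_le_gap N a b : 0 <= a -> a < b ->
  (forall c t, 0 < c -> c < t -> gap f c t <= N) ->
  forall m, m = (P b - P a) / (b - a) ->
  (\int[mu]_(x in `]a, b[) `|f x - m|) / (b - a) <= N.
Proof.
move=> a0 ab gapN m mdef.
have N0 : 0 <= N.
  by apply: le_trans (gapN 1 2 _ _); [apply: gap_ge0; lra|lra|lra].
have mE : m * (b - a) = P b - P a by rewrite mdef; field; lra.
have [c [ac cb fm mf]] := level_crossing fni m a0 ab.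
rewrite (oscillation_crossing fi a0 ac cb mE fm mf).
set V := P c - P a - m * (c - a).
have [V0|V0] := leP V 0.
  rewrite ler_pdivrMr ?subr_gt0//.
  have : 0 <= N * (b - a) by apply: mulr_ge0; lra.
  by lra.
have {}ac : a < c.
  rewrite lt_neqAle ac andbT; apply/eqP => eac.
  by move: V0; rewrite /V -eac !subrr mulr0 subrr ltxx.
have {}cb : c < b.
  rewrite lt_neqAle cb andbT; apply/eqP => ecb.
  by move: V0; rewrite /V ecb mE subrr ltxx.
have c0 : 0 < c by lra.
pose A := Hardy f c - m; pose B := V / (b - c).
have BV : B * (b - c) = V by rewrite /B; field; lra.
have Pc : P c = c * (A + m) by rewrite /A HardyE; field; lra.
have B0 : 0 < B by rewrite divr_gt0//; lra.
have AV : V <= A * (c - a).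
  suff : a * A <= P a - m * a by rewrite /V Pc; nra.
  have [->|na] := eqVneq a 0; first by rewrite primitive0 mulr0 !mul0r subr0.
  have {}a0 : 0 < a by lra.
  have -> : P a = a * Hardy f a by rewrite HardyE; field; lra.
  have := Hardy_nincr a0 (ltW ac); rewrite /A; nra.
have A0 : 0 < A by nra.
(* The value for which c * A = (t - c) * B. *)
pose t := c * (A + B) / B.
have tB : t * B = c * (A + B) by rewrite /t; field; lra.
have bt : b <= t by nra.
have fb : f b * (b - c) <= (m - B) * (b - c).
  have := primitiveB_ge fi fni (ltW c0) (ltW cb).
  have -> : P b = m * (b - a) + P a by lra.
  have := BV; rewrite /V; nra.
have {}fb : f b <= m - B by nra.
have Pt : P t <= P c + (m - B) * (t - c).
  have := primitiveB_le fi fni (lt_trans c0 cb) bt.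
  have -> : P b = m * (b - a) + P a by lra.
  have := BV; rewrite /V; nra.
have t0 : 0 < t by lra.
have AB0 : 0 < A + B by lra.
have Ft : Hardy f t <= m + c / t * A - B * (1 - c / t).
  rewrite HardyE ler_pdivrMr//; apply: (le_trans Pt).
  by rewrite Pc le_eqVlt; apply/orP; left; apply/eqP; field; lra.
have ct : c / t = B / (A + B) by rewrite /t; field; apply/and3P; split; lra.
have Fc : Hardy f c = A + m by rewrite /A; ring.
have : 2 * (A * B / (A + B)) <= N.
  apply: le_trans (gapN c t c0 _); last lra.
  rewrite /gap Fc -[leRHS]mulrA ler_pM2l//.
  have k0 : 0 < c / t by exact: divr_gt0.
  have -> : A * B / (A + B) = c / t * ((1 - c / t) * (A + B)).
    by rewrite ct; field; lra.
  by rewrite ler_pM2l//; lra.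
apply: le_trans; rewrite -[leLHS]mulrA ler_pM2l// ler_pdivrMr; last lra.
rewrite mulrAC ler_pdivlMr//; nra.
Qed.

End oscillation_and_gap.

(** * Differential calculus of primitives *)

Section calculus.
Context {R : realType}.
Implicit Types (f h u du : R -> R) (I : set R) (a b c t x y : R).

Local Notation mu := (@lebesgue_measure R).

Lemma ge0_is_derive_le u du a b : 0 < a -> a <= b ->
  (forall x, 0 < x -> is_derive x 1 u (du x)) ->
  (forall x, a < x -> x < b -> 0 <= du x) -> u a <= u b.
Proof.
move=> a0; rewrite le_eqVlt => /predU1P[->//|ab] dr du0.
have [||c /[!in_itv]/= /andP[ac cb] e] := @MVT R u du a b ab.
- by move=> x /[!in_itv]/= /andP[ax _]; apply: dr; lra.
- apply: derivable_within_continuous => x /[!in_itv]/= /andP[ax _].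
  by have [] := dr x (lt_le_trans a0 ax).
by rewrite -subr_ge0 e mulr_ge0 ?du0//; lra.
Qed.

Lemma le0_is_derive_le u du a b : 0 < a -> a <= b ->
  (forall x, 0 < x -> is_derive x 1 u (du x)) ->
  (forall x, a < x -> x < b -> du x <= 0) -> u b <= u a.
Proof.
move=> a0 ab dr du0; rewrite -lerN2.
apply: (@ge0_is_derive_le (fun x => - u x) (fun x => - du x)) => //.
- by move=> x x0; have := is_deriveN (dr x x0); apply.
- by move=> x ax xb; rewrite oppr_ge0 du0.
Qed.

Lemma is_derive_mulrl k x : is_derive x 1 (fun s : R => k * s) k.
Proof.
have := is_deriveZ k (is_derive_id x (1 : R)).
by rewrite -[_ *: _]/(_ * _) mulr1; apply.
Qed.

Lemma is_derive_mulrln k x : 0 < x ->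
  is_derive x 1 (fun s : R => k * ln s) (k / x).
Proof. by move=> x0; have := is_deriveZ k (is_derive1_ln x0); apply. Qed.

Lemma ln_sub1 x : 0 < x -> ln x <= x - 1.
Proof.
move=> x0; have := @le_ln1Dx R (x - 1).
have -> : 1 + (x - 1) = x by ring.
by apply; lra.
Qed.

Section primitive_calculus.
Variable f : R -> R.
Hypothesis fi : loc_integrable f.

Lemma integrable_itvcc b :
  mu.-integrable `[0, b] (EFin \o f).
Proof.
have /integrableP[m i] := loc_integrableoo fi b (lexx 0).
apply/integrableP; split.
  exact/emeasurable_fun_itv_obnd_cbndP/emeasurable_fun_itv_bndo_bndcP.
rewrite integral_itv_bndoo//; exact: measurableT_comp.
Qed.

(** Derivatives are available on the open half-line only; this supplies the
    boundary value at 0. *)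
Lemma primitive_near0 e : 0 < e ->
  exists2 d, 0 < d & forall x, x < d -> `|primitive f x| <= e.
Proof.
move=> e0; have := parameterized_integral_cvg_left ltr01 (integrable_itvcc 1).
move=> /cvgrPdist_le /(_ e e0) [d/= d0 de].
exists d => // x xd; have [x0|x0] := ltP 0 x; last first.
  rewrite /primitive set_itv_ge ?Rintegral_set0 ?normr0 ?ltW//.
  by rewrite bnd_simp -leNgt.
have : ball 0 d x by rewrite /ball/= sub0r normrN gtr0_norm.
move=> /de; rewrite /= sub0r normrN /parameterized_integral.
by rewrite Rintegral_itvoo.
Qed.

Lemma is_derive_primitive x : 0 < x -> {for x, continuous f} ->
  is_derive x 1 (primitive f) (f x).
Proof.
move=> x0 cf.
have -> : primitive f = fun y => \int[mu]_(t in `]0, y]) f t.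
  by apply/funext => y; rewrite Rintegral_itvoo.
have xu : x < x + 1 by rewrite ltrDl.
have fiu :
    mu.-integrable [set` Interval (BRight 0) (BRight (x + 1))] (EFin \o f).
  apply: integrableS (integrable_itvcc (x + 1)) => //.
  by apply: subset_itvr; rewrite bnd_simp.
have [//|d e] := continuous_FTC1 xu fiu _ cf.
by apply: DeriveDef; [exact: d|rewrite -derive1E].
Qed.

End primitive_calculus.

Section hardy_calculus.
Variable f : R -> R.
Hypothesis fi : loc_integrable f.
Hypothesis fni : {in `]0, +oo[ &, nonincreasing_fun f}.

(** Near x, concavity makes the primitive Lipschitz, with slopes between
    f (2x) and f (x / 2). *)
Lemma continuous_primitive x : 0 < x -> {for x, continuous (primitive f)}.
Proof.
move=> x0; apply/cvgrPdist_le => e e0.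
pose K := `|f (x / 2)| + `|f (2 * x)| + 1.
have K0 : 0 < K by rewrite /K; have := normr_ge0 (f (x / 2));
  have := normr_ge0 (f (2 * x)); lra.
pose d := Num.min (x / 2) (e / K).
have d0 : 0 < d by rewrite lt_min divr_gt0//= divr_gt0.
have lip a b : x / 2 <= a -> a <= b -> b <= 2 * x ->
    `|primitive f a - primitive f b| <= K * (b - a).
  move=> xa ab bx; rewrite distrC.
  have a0 : 0 < a by lra.
  have l := primitiveB_ge fi fni (ltW a0) ab.
  have u := primitiveB_le fi fni a0 ab.
  have fa : f a <= K.
    have : f a <= f (x / 2) by apply: (nonincreasing_itvy fni); lra.
    have := ler_norm (f (x / 2)); have := normr_ge0 (f (2 * x)).
    by rewrite /K; lra.
  have fb : - K <= f b.
    have : f (2 * x) <= f b by apply: (nonincreasing_itvy fni); lra.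
    have := ler_norm (- f (2 * x)); have := normr_ge0 (f (x / 2)).
    by rewrite normrN /K; lra.
  by rewrite ler_norml; apply/andP; split; nra.
near=> y.
have : `|x - y| < d by near: y; apply/nbhs_ballP; exists d.
rewrite lt_min => /andP[h1]; rewrite ltr_pdivlMr// mulrC => h2.
have [xy|yx] := leP x y.
  have e1 : `|x - y| = y - x by rewrite distrC ger0_norm; lra.
  rewrite e1 in h1 h2.
  by apply: (le_trans (lip x y _ _ _)); lra.
have e1 : `|x - y| = x - y by rewrite ger0_norm; lra.
rewrite e1 in h1 h2.
by rewrite distrC; apply: (le_trans (lip y x _ _ _)); lra.
Unshelve. all: by end_near. Qed.

Lemma continuous_Hardy x : 0 < x -> {for x, continuous (Hardy f)}.
Proof.
move=> x0; have -> : Hardy f = (fun y => y^-1) \* primitive f by [].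
apply: continuousM; last exact: continuous_primitive.
by apply: inv_continuous; rewrite gt_eqF.
Qed.

End hardy_calculus.
End calculus.

(** * The norm as a supremum of gaps, and the upper bound *)

Section bmo_gap.
Context {R : realType}.
Implicit Types (f h u du : R -> R) (I : set R) (a b c t x y N : R).

Local Notation mu := (@lebesgue_measure R).

Section one_function.
Variable f : R -> R.
Hypothesis fi : loc_integrable f.
Hypothesis fni : {in `]0, +oo[ &, nonincreasing_fun f}.

(** The intervals (0, t) already give all gaps by [oscillation_ge], and no
    other interval does better by [oscillation_le_gap]. *)
Lemma bmo_leP N :
  (bmo f <= N%:E)%E <-> forall c t, 0 < c -> c < t -> gap f c t <= N.
Proof.
rewrite /bmo asboolT//; split=> [/ereal_supP fN c t c0 ct|fN].
  have t0 : 0 < t by lra.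
  have := fN _ (imageP _ (bounded_itvoo (lexx 0) t0)).
  rewrite oscillation_itv// lee_fin; apply: le_trans.
  rewrite ler_pdivlMr ?subr_gt0//.
  have mE : (primitive f t - primitive f 0) / (t - 0) * (t - 0) =
      primitive f t - primitive f 0 by field; lra.
  apply: le_trans (oscillation_ge fi (lexx 0) (ltW c0) (ltW ct) mE).
  rewrite le_eqVlt; apply/orP; left; apply/eqP.
  by rewrite /gap !HardyE primitive0; field; lra.
apply/ereal_supP => _ [I bI <-].
have [a [b [b0 [b1 [a0 ab ->]]]]] := bounded_itvP bI.
rewrite oscillation_itv// lee_fin.
exact: oscillation_le_gap.
Qed.

Variable N : R.
Hypothesis fN : forall c t, 0 < c -> c < t -> gap f c t <= N.

(** As P(2x) <= P(x) + x f(x), the difference F(x) - F(2x) is at least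
    (F(x) - f(x)) / 2. *)
Lemma Hardy_le_gap x : 0 < x -> Hardy f x <= f x + 2 * N.
Proof.
move=> x0; have x2 : x < 2 * x by lra.
have := fN x0 x2; have := primitiveB_le fi fni x0 (ltW x2).
have -> : primitive f x = x * Hardy f x by rewrite HardyE; field; lra.
have -> : primitive f (2 * x) = 2 * x * Hardy f (2 * x).
  by rewrite HardyE; field; lra.
rewrite /gap.
have -> : x / (2 * x) = 2^-1 by field; lra.
nra.
Qed.

(** Only the integrability at 0 is at stake; it comes from f <= Hf <= f + 2N. *)
Lemma loc_integrable_Hardy : loc_integrable (Hardy f).
Proof.
move=> I bI; have [a [b [b0 [b1 [a0 ab eI]]]]] := bounded_itvP bI.
have [_ _ I0 _] := bI.
have mI : measurable I by rewrite eI; exact: measurable_itv.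
have gi := loc_integrable_subr (loc_integrable_dist fi 0) (- (2 * N)) bI.
apply: le_integrable gi => //.
  apply/measurable_EFinP; apply: measurable_funS I0 _ => //.
  apply: open_continuous_measurable_fun => //.
  by move=> x; rewrite inE/= in_itv/= andbT; exact: continuous_Hardy.
move=> x /I0 /=; rewrite in_itv/= andbT => x0; rewrite lee_fin subr0 opprK.
have x2 : x < 2 * x by lra.
have N0 := le_trans (gap_ge0 fi fni x0 x2) (fN x0 x2).
rewrite [leRHS]ger0_norm; last by rewrite addr_ge0// mulr_ge0.
have := Hardy_le_gap x0; have := Hardy_ge fi fni x0.
have := ler_norm (f x); have := ler_norm (- f x); rewrite normrN => ? ? ? ?.
by rewrite ler_norml; apply/andP; split; lra.
Qed.

End one_function.

Section hardy_gap.
Variable f : R -> R.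
Hypothesis fi : loc_integrable f.
Hypothesis fni : {in `]0, +oo[ &, nonincreasing_fun f}.

Lemma Hardy_nonincreasing : {in `]0, +oo[ &, nonincreasing_fun (Hardy f)}.
Proof.
move=> x y; rewrite !in_itv/= !andbT => x0 y0 yx; exact: Hardy_nincr.
Qed.

Hypothesis Fi : loc_integrable (Hardy f).

Lemma is_derive_primitive_Hardy x : 0 < x ->
  is_derive x 1 (primitive (Hardy f)) (Hardy f x).
Proof.
by move=> x0; apply: is_derive_primitive => //; exact: continuous_Hardy.
Qed.

(** The dilation average of the gaps of f, written without a change of
    variables: the function D below is the integral of F(cs) - F(ts) - L, with
    a nonpositive derivative because (cs) / (ts) = c / t, and it tends to 0
    at 0. *)
Lemma gap_Hardy_le N : (forall c t, 0 < c -> c < t -> gap f c t <= N) ->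
  forall c t, 0 < c -> c < t -> gap (Hardy f) c t <= N.
Proof.
move=> fN c t c0 ct; have t0 : 0 < t by lra.
(* gap f c t <= N means F(c) - F(t) <= L. *)
pose L := N * t / (2 * c).
pose G := primitive (Hardy f).
pose D s := c^-1 * G (c * s) - t^-1 * G (t * s) - L * s.
have dG k x : 0 < k -> 0 < x ->
    is_derive x 1 (fun s => k^-1 * G (k * s)) (Hardy f (k * x)).
  move=> k0 x0.
  have kx : 0 < k * x by exact: mulr_gt0.
  have := is_deriveZ k^-1
    (is_derive1_comp (is_derive_primitive_Hardy kx) (is_derive_mulrl k x)).
  rewrite -[_ *: _]/(_ * _) mulrCA mulVf ?gt_eqF// mulr1; apply.
have dD x : 0 < x -> is_derive x 1 D (Hardy f (c * x) - Hardy f (t * x) - L).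
  move=> x0.
  exact: is_deriveB (is_deriveB (dG c x c0 x0) (dG t x t0 x0))
    (is_derive_mulrl L x).
have dD0 x : 0 < x -> Hardy f (c * x) - Hardy f (t * x) - L <= 0.
  move=> x0; have := fN (c * x) (t * x) (mulr_gt0 c0 x0).
  rewrite ltr_pM2r// => /(_ ct); rewrite /gap.
  have -> : c * x / (t * x) = c / t by field; lra.
  have k0 : 0 < 2 * (c / t) by rewrite mulr_gt0// divr_gt0.
  rewrite mulrC -ler_pdivlMr//.
  have -> : N / (2 * (c / t)) = L by rewrite /L; field; lra.
  lra.
have D1 : D 1 <= 0.
  rewrite leNgt; apply/negP => D1.
  have e0 : 0 < D 1 * c / 4 by rewrite divr_gt0// mulr_gt0.
  have [d d0 Gd] := primitive_near0 Fi e0.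
  pose s := Num.min 1 (d / (2 * t)).
  have s0 : 0 < s by rewrite /s lt_min ltr01 divr_gt0// mulr_gt0.
  have s1 : s <= 1 by rewrite /s ge_min lexx.
  have st : t * s < d.
    have : s <= d / (2 * t) by rewrite /s ge_min lexx orbT.
    by rewrite ler_pdivlMr ?mulr_gt0//; nra.
  have sc : c * s < d by nra.
  have : D 1 <= D s.
    by apply: (le0_is_derive_le s0 s1 dD) => x sx _; apply: dD0; lra.
  have := Gd _ st; have := Gd _ sc; rewrite !ler_norml -/G.
  move=> /andP[_ Gc] /andP[Gt _].
  have L0 : 0 <= L * s.
    have N0 := gap_ge0 fi fni c0 ct; have := fN _ _ c0 ct.
    move=> N1; rewrite /L mulr_ge0//; last exact: ltW.
    by rewrite divr_ge0 ?mulr_ge0//; lra.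
  have : c^-1 * G (c * s) <= D 1 / 4.
    by rewrite [leLHS]mulrC ler_pdivrMr//; lra.
  have : - (D 1 / 4) <= t^-1 * G (t * s).
    by rewrite [leRHS]mulrC ler_pdivlMr//; nra.
  rewrite [D s]/D; lra.
move: D1; rewrite /D !mulr1 /gap !HardyE -/G => D1.
have k0 : 0 < c / t by exact: divr_gt0.
have -> : N = 2 * (c / t) * L by rewrite /L; field; lra.
by rewrite ler_pM2l ?invr_gt0 ?mulr_gt0 ?invr_gt0//; lra.
Qed.

End hardy_gap.
End bmo_gap.

(** * The lower bound *)

Section lower_bound.
Context {R : realType}.
Implicit Types (a b c t x y s : R).

Local Notation mu := (@lebesgue_measure R).

Section fixed_function.
Variable f : R -> R.
Hypothesis fi : loc_integrable f.
Hypothesis fni : {in `]0, +oo[ &, nonincreasing_fun f}.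
Hypothesis Fi : loc_integrable (Hardy f).

Local Notation P := (primitive f).
Local Notation Q := (primitive (Hardy f)).

Lemma is_derive_primitive_Hardy_subr A B x : 0 < x ->
  is_derive x 1 (fun s => Q s - A * s - B * ln s) (Hardy f x - A - B / x).
Proof.
move=> x0; have := is_deriveB (is_deriveB
  (is_derive_primitive_Hardy fi fni Fi x0) (is_derive_mulrl A x))
  (is_derive_mulrln B x0).
by apply.
Qed.

Lemma primitive_chord a b A s : 0 < a -> a < s -> s < b ->
  P b - P a = A * (b - a) -> P a + A * (s - a) <= P s.
Proof.
move=> a0 as_ sb bA.
have h1 := primitiveB_ge fi fni (ltW a0) (ltW as_).
have h2 := primitiveB_le fi fni (lt_trans a0 as_) (ltW sb).
nra.
Qed.

(** On (a, b) the concave P is above its chord, so F(x) = P(x) / x is at least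
    A + B / x with B the intercept of the chord. *)
Lemma primitive_Hardy_chord a b A : 0 < a -> a < b ->
  P b - P a = A * (b - a) ->
  P b - P a + (P a - A * a) * (ln b - ln a) <= Q b - Q a.
Proof.
move=> a0 ab bA; set B := P a - A * a.
have := ge0_is_derive_le a0 (ltW ab)
  (fun x xpos => is_derive_primitive_Hardy_subr A B xpos).
rewrite bA => h; suff: Q a - A * a - B * ln a <= Q b - A * b - B * ln b by lra.
apply: h => x ax xb.
have x0 : 0 < x by lra.
have -> : Hardy f x - A - B / x = (P x - A * x - B) / x.
  by rewrite HardyE; field; lra.
rewrite divr_ge0//; last lra.
by have := primitive_chord a0 ax xb bA; rewrite /B; lra.
Qed.

(** Same comparison with the line of slope f t through (t, P t), which is
    above P. *)
Lemma primitive_Hardy_tangent y t : 0 < y -> y < t ->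
  Q t - Q y <= f t * (t - y) + (P t - t * f t) * (ln t - ln y).
Proof.
move=> y0 yt; set q := P t - t * f t.
have := le0_is_derive_le y0 (ltW yt)
  (fun x xpos => is_derive_primitive_Hardy_subr (f t) q xpos).
move=> h; suff: Q t - f t * t - q * ln t <= Q y - f t * y - q * ln y by lra.
apply: h => x yx xt.
have x0 : 0 < x by lra.
have -> : Hardy f x - f t - q / x = (P x - f t * x - q) / x.
  by rewrite HardyE; field; lra.
rewrite pmulr_lle0 ?invr_gt0//.
have := primitiveB_ge fi fni (ltW x0) (ltW xt); rewrite /q; lra.
Qed.

(** Convexity of Q - P as a function of ln x: its derivative in that variable
    is P(x) - x f(x), which is nondecreasing.  As P has a derivative only
    where f is continuous, chords and tangents of P replace derivatives. *)
Lemma excess_tangent y t : 0 < y -> 0 < t ->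
  Q t - P t + (P t - t * f t) * (ln y - ln t) <= Q y - P y.
Proof.
move=> y0 t0; have [yt|ty|->] := ltgtP y t; last by lra.
- have := primitive_Hardy_tangent y0 yt.
  have := primitiveB_ge fi fni (ltW y0) (ltW yt); lra.
- pose A := (P y - P t) / (y - t).
  have AE : P y - P t = A * (y - t) by rewrite /A; field; lra.
  have h := primitive_Hardy_chord t0 ty AE.
  have Af : A <= f t.
    rewrite /A ler_pdivrMr; last lra.
    by rewrite mulrC; apply: primitiveB_le => //; exact: ltW.
  have : ln t <= ln y by rewrite ler_ln ?posrE// ltW.
  move=> tyl; have : 0 <= (f t - A) * t * (ln y - ln t).
    by rewrite !mulr_ge0//; lra.
  lra.
Qed.

(** The derivative of G = Q / x is - (Q - P) / x^2; with the tangent of Q - P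
    at t in place of Q - P, it has the antiderivative that appears on the
    left. *)
Lemma Hardy_Hardy_sub_ge t a b : 0 < t -> 0 < a -> a <= b ->
  (Q t - P t + (P t - t * f t) * (1 + ln a - ln t)) / a -
  (Q t - P t + (P t - t * f t) * (1 + ln b - ln t)) / b <=
  Hardy (Hardy f) a - Hardy (Hardy f) b.
Proof.
move=> t0 a0 ab; set p := Q t - P t; set q := P t - t * f t.
pose k := p + q * (1 - ln t).
pose u y := (Q y - 0 * y - q * ln y - k) * y^-1.
have du x : 0 < x -> is_derive x 1 u
    ((P x - Q x + p + q * (ln x - ln t)) / x ^+ 2).
  move=> x0.
  have nx : x != 0 by rewrite gt_eqF.
  have d1 : is_derive x 1 (fun y => Q y - 0 * y - q * ln y - k)
      (Hardy f x - 0 - q / x - 0).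
    exact: is_deriveB (is_derive_primitive_Hardy_subr 0 q x0)
      (is_derive_cst k x (1 : R)).
  have d2 := @is_deriveV R id x 1 1 nx (is_derive_id _ _).
  have := is_deriveM d1 d2.
  move=> d; apply: (is_derive_eq d).
  rewrite -![_ *: _]/(_ * _) /= HardyE /k; field; lra.
have : u b <= u a.
  apply: (le0_is_derive_le a0 ab du) => x ax xb.
  have x0 : 0 < x by lra.
  have := excess_tangent x0 t0; rewrite -/p -/q => h.
  by rewrite pmulr_lle0 ?invr_gt0 ?exprn_gt0//; lra.
by rewrite /u !HardyE -/p -/q /k; lra.
Qed.

(** With B the intercept of the chord of P over (c, t), both (Q - P)(t) and
    P(t) - t f(t) are bounded below by multiples of B, namely
    B (ln t - ln c) and B, while t * gap f c t equals B (2 - 2 c / t). *)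
Lemma excess_ge_gap c t : 0 < c -> c < t ->
  t * gap f c t <= Q t - P t + (P t - t * f t) * (1 - ln 2).
Proof.
move=> c0 ct; have t0 : 0 < t by lra.
pose A := (P t - P c) / (t - c).
have AE : P t - P c = A * (t - c) by rewrite /A; field; lra.
have := primitive_Hardy_chord c0 ct AE; set B := P c - A * c => h.
have fA : f t <= A.
  rewrite /A ler_pdivlMr; last lra.
  by rewrite mulrC; apply: primitiveB_ge => //; exact: ltW.
have Af : A <= f c.
  rewrite /A ler_pdivrMr; last lra.
  by rewrite mulrC; apply: primitiveB_le => //; exact: ltW.
have B0 : 0 <= B.
  have := primitiveB_ge fi fni (lexx 0) (ltW c0); rewrite primitive0 /B; nra.
have pc : 0 <= Q c - P c.
  have := Hardy_ge Fi (Hardy_nonincreasing fi fni) c0.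
  by rewrite !HardyE ler_pM2r ?invr_gt0//; lra.
have qB : B <= P t - t * f t by rewrite /B; nra.
have l2 : ln 2 <= 1 :> R by have := @ln_sub1 R 2 ltac:(lra); lra.
have lct : ln 2 + ln c - ln t <= 2 * c / t - 1.
  have ct0 : 0 < 2 * c / t by rewrite divr_gt0// mulr_gt0.
  have := ln_sub1 ct0.
  rewrite ln_div ?posrE ?mulr_gt0// lnM ?posrE//; lra.
have -> : t * gap f c t = B * (2 - 2 * c / t).
  rewrite /gap !HardyE.
  have -> : P t = P c + A * (t - c) by lra.
  by rewrite /B; field; lra.
nra.
Qed.

(** The points a and b are those where the gap of the Hardy transform of the
    indicator of (0, t / 2) is largest. *)
Lemma alpha0_gap_le c t : 0 < c -> c < t ->
  exists a b : R, [/\ 0 < a, a < b & alpha0 * gap f c t <= gap (Hardy f) a b].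
Proof.
move=> c0 ct; have t0 : 0 < t by lra.
have [g1 gE] := @gamma1P R; rewrite /alpha0; set g := gamma1 in g1 gE *.
have := ln_gt0 g1; move: gE; set k := ln g => gE k0.
have g0 : 0 < g by lra.
have k1 : 0 < 1 + k by lra.
rewrite ln_div ?posrE// -/k in gE.
exists (g / (1 + k) * t / 2), (g * t / 2).
set a := _ / 2; set b := g * t / 2.
have b0 : 0 < b by rewrite divr_gt0// mulr_gt0.
have a0 : 0 < a by rewrite divr_gt0// mulr_gt0// divr_gt0.
have ab : a < b.
  by rewrite /a /b ltr_pM2r// ltr_pM2r// ltr_pdivrMr// ltr_pMr//; lra.
split => //.
have lb : ln b = k + ln t - ln 2.
  by rewrite /b ln_div ?posrE ?mulr_gt0// lnM ?posrE.
have la : ln a = k / (1 + k) + ln t - ln 2.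
  have gk0 : 0 < g / (1 + k) by exact: divr_gt0.
  have gkt0 : 0 < g / (1 + k) * t by exact: mulr_gt0.
  by rewrite /a ln_div ?posrE// lnM ?posrE// ln_div ?posrE// -/k gE.
have := Hardy_Hardy_sub_ge t0 a0 (ltW ab).
rewrite la lb; have := excess_ge_gap c0 ct.
set p := Q t - P t; set q := P t - t * f t => h1 h2.
have ab' : a / b = (1 + k)^-1 by rewrite /a /b; field; lra.
rewrite /gap ab' -/(gap f c t).
apply: (@le_trans _ _ (4 * k / (g * (1 + k)) * ((p + q * (1 - ln 2)) / t))).
  rewrite ler_pM2l; last by rewrite divr_gt0 ?mulr_gt0.
  by rewrite ler_pdivlMr// mulrC.
have k2 : 0 <= 2 * (1 + k)^-1 by rewrite mulr_ge0// invr_ge0 ltW.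
apply: le_trans (ler_wpM2l k2 h2).
rewrite le_eqVlt; apply/orP; left; apply/eqP.
by rewrite /a /b; field; lra.
Qed.

End fixed_function.
End lower_bound.

(** * The maximum that defines alpha0 *)

Section gamma1_maximum.
Context {R : realType}.
Implicit Types (c t u x y : R).

Let gamma1_aux_slope u : R := 1 - u^-2 - u^-1.

Let gamma1_aux_slope_le x y : 0 < x -> x <= y ->
  gamma1_aux_slope x <= gamma1_aux_slope y.
Proof.
move=> x0 xy; have y0 : 0 < y by lra.
have yx : y^-1 <= x^-1 by rewrite lef_pV2 ?posrE.
have yi : 0 < y^-1 by rewrite invr_gt0.
rewrite /gamma1_aux_slope -!exprVn !expr2; nra.
Qed.

Let u1 : R := 1 + ln gamma1.

Let u1_gt1 : 1 < u1.
Proof. by have [g1 _] := @gamma1P R; rewrite /u1 ltrDl ln_gt0. Qed.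

Let gamma1_aux_u1 : gamma1_aux u1 = 0.
Proof. by have /gamma1_eqE[] := @gamma1P R. Qed.

Let gamma1_aux_le0 u : 1 <= u -> u <= u1 -> gamma1_aux u <= 0.
Proof.
move=> u1' uu; have u0 : 0 < u by lra.
have [d0|d0] := leP 0 (gamma1_aux_slope u).
  rewrite -gamma1_aux_u1.
  apply: (ge0_is_derive_le u0 uu (@is_derive_gamma1_aux R)) => x ux _.
  by apply: (le_trans d0); apply: gamma1_aux_slope_le => //; exact: ltW.
rewrite -(@gamma1_aux1 R).
apply: (le0_is_derive_le ltr01 u1' (@is_derive_gamma1_aux R)) => x x1 xu.
apply: le_trans (ltW d0); apply: gamma1_aux_slope_le; lra.
Qed.

(** Between its two zeros gamma1_aux has a critical point c, given by the
    equation c^2 - c - 1 = 0, after which it increases. *)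
Let gamma1_aux_ge0 u : u1 <= u -> 0 <= gamma1_aux u.
Proof.
move=> uu; have h1 := u1_gt1.
have [c /andP[c1 cu] ec] :=
  gamma1_aux_Rolle (lexx 1) u1_gt1 gamma1_aux1 gamma1_aux_u1.
have dc : gamma1_aux_slope c = 0.
  have c0 : c != 0 by rewrite gt_eqF//; lra.
  have -> : gamma1_aux_slope c = (c ^+ 2 - c - 1) / c ^+ 2.
    by rewrite /gamma1_aux_slope; field.
  by rewrite ec mul0r.
have u10 : 0 < u1 by lra.
rewrite -gamma1_aux_u1.
apply: (ge0_is_derive_le u10 uu (@is_derive_gamma1_aux R)) => x ux _.
by rewrite -dc; apply: gamma1_aux_slope_le; lra.
Qed.

Let is_derive_profile u : 0 < u ->
  is_derive u 1 (fun y => (y - 1 - ln y) * expR (1 - y))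
    (- (gamma1_aux u * expR (1 - u))).
Proof.
move=> u0.
have d1 : is_derive u 1 (fun y => y - 1 - ln y) (1 - u^-1).
  have := is_deriveB (is_deriveB (is_derive_id u (1:R))
    (is_derive_cst (1 : R) u 1)) (is_derive1_ln u0).
  by rewrite subr0; apply.
have d2 : is_derive u 1 (fun y : R => 1 - y) (- 1).
  have := is_deriveB (is_derive_cst (1 : R) u 1) (is_derive_id u (1:R)).
  by rewrite sub0r; apply.
have d3 : is_derive u 1 (fun y => expR (1 - y)) (expR (1 - u) * - 1).
  exact: (@is_derive1_comp R expR (fun y => 1 - y)) (is_derive_expR _) d2.
apply: (is_derive_eq (is_deriveM d1 d3)).
by rewrite -![_ *: _]/(_ * _) /= /gamma1_aux; ring.
Qed.

(** In the variable u = 1 + ln t the quotient is (u - 1 - ln u) e^(1 - u), whose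
    derivative has the sign of - gamma1_aux u.  The convex function gamma1_aux
    vanishes at 1 and at 1 + ln gamma1, so the quotient increases up to
    gamma1 and decreases afterwards. *)
Lemma ln_ratio_le_alpha0 t : 1 <= t ->
  (ln t - ln (1 + ln t)) / t <= alpha0 / 4.
Proof.
move=> t1; have t0 : 0 < t by lra.
have lt0 : 0 <= ln t by exact: ln_ge0.
pose h y : R := (y - 1 - ln y) * expR (1 - y).
have hE : (ln t - ln (1 + ln t)) / t = h (1 + ln t).
  rewrite /h; have -> : 1 - (1 + ln t) = - ln t by ring.
  by rewrite expRN lnK ?posrE//; congr (_ / _); ring.
have hu1 : h u1 = alpha0 / 4.
  have [g1 e] := @gamma1P R.
  have := ln_gt0 g1; rewrite /h /alpha0 /u1; set g := gamma1 in g1 e *.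
  have -> : 1 - (1 + ln g) = - ln g by ring.
  rewrite expRN lnK ?posrE; last lra.
  rewrite ln_div ?posrE in e; [|lra|have := ln_gt0 g1; lra].
  have -> : 1 + ln g - 1 - ln (1 + ln g) = ln g / (1 + ln g) by lra.
  move: (ln g) => k k0; field; lra.
rewrite hE -hu1.
have [tu|ut] := leP (1 + ln t) u1.
  apply: (ge0_is_derive_le _ tu is_derive_profile); first lra.
  move=> x tx xu; rewrite oppr_ge0 mulr_le0_ge0 ?expR_ge0//.
  by apply: gamma1_aux_le0; lra.
have h1 := u1_gt1.
apply: (le0_is_derive_le _ (ltW ut) is_derive_profile); first lra.
move=> x ux xt; rewrite oppr_le0 mulr_ge0 ?expR_ge0//.
by apply: gamma1_aux_ge0; lra.
Qed.

Lemma alpha0_gt0 : 0 < alpha0 :> R.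
Proof.
have [g1 _] := @gamma1P R; have := ln_gt0 g1; rewrite /alpha0 => l0.
by rewrite divr_gt0 ?mulr_gt0//; lra.
Qed.

End gamma1_maximum.

(** * The indicator of the unit interval *)

Section step_function.
Context {R : realType}.
Implicit Types (c t x y : R).

Local Notation mu := (@lebesgue_measure R).

Definition step : R -> R := fun x => if x < 1 then 1 else 0.

Lemma step_ge0 x : 0 <= step x.
Proof. by rewrite /step; case: ifP. Qed.

Lemma step_le1 x : step x <= 1.
Proof. by rewrite /step; case: ifP. Qed.

Lemma nonincreasing_step : nonincreasing_fun step.
Proof.
move=> x y xy; rewrite /step; case: (ltP y 1) => [y1|_]; last by case: ifP.
by rewrite (le_lt_trans xy y1).
Qed.

Lemma loc_integrable_step : loc_integrable step.
Proof.
move=> I bI; have [a [b [b0 [b1 [a0 ab eI]]]]] := bounded_itvP bI.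
rewrite eI; apply: measurable_bounded_integrable => //.
- by rewrite /= measure_itv ?ltW// ltry.
- exact: nonincreasing_measurable nonincreasing_step.
exists 1; split => // M M1 x _ /=.
by rewrite ger0_norm ?step_ge0// (le_trans (step_le1 x))// ltW.
Qed.

Lemma step_nincr : {in `]0, +oo[ &, nonincreasing_fun step}.
Proof. by move=> x y _ _; exact: nonincreasing_step. Qed.

Lemma primitive_step_le1 x : 0 < x -> x <= 1 -> primitive step x = x.
Proof.
move=> x0 x1; rewrite /primitive.
rewrite (@eq_Rintegral _ _ _ _ _ (cst 1)) ?Rintegral_cstoo ?ltW//.
  by rewrite subr0 mul1r.
move=> y; rewrite inE/= in_itv/= => /andP[_ yx].
by rewrite /step (lt_le_trans yx x1).
Qed.

Lemma primitive_step_ge1 x : 1 <= x -> primitive step x = 1.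
Proof.
move=> x1; rewrite -[RHS](primitive_step_le1 ltr01 (lexx 1)).
apply/eqP; rewrite -subr_eq0 (primitiveB loc_integrable_step ler01 x1).
rewrite (@eq_Rintegral _ _ _ _ _ (cst 0)) ?Rintegral_cstoo ?mul0r//.
move=> y; rewrite inE/= in_itv/= => /andP[y1 _].
by rewrite /step ltNge (ltW y1).
Qed.

Lemma Hardy_step_le1 x : 0 < x -> x <= 1 -> Hardy step x = 1.
Proof. by move=> x0 x1; rewrite HardyE primitive_step_le1// divff// gt_eqF. Qed.

Lemma Hardy_step_ge1 x : 1 <= x -> Hardy step x = x^-1.
Proof. by move=> x1; rewrite HardyE primitive_step_ge1// mul1r. Qed.

Lemma gap_step12 : gap step 1 2 = 2^-1.
Proof. by rewrite /gap Hardy_step_le1// Hardy_step_ge1; lra. Qed.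

Lemma gap_step_le c t : 0 < c -> c < t -> gap step c t <= 2.
Proof.
move=> c0 ct; have t0 : 0 < t by lra.
have F1 x : 0 < x -> Hardy step x <= 1.
  move=> x0; have [x1|x1] := leP x 1; first by rewrite Hardy_step_le1.
  by rewrite Hardy_step_ge1 ?invf_le1 ?ltW.
have F0 x : 0 < x -> 0 <= Hardy step x.
  move=> x0; exact: le_trans (step_ge0 x)
    (Hardy_ge loc_integrable_step step_nincr x0).
have k1 : c / t <= 1 by rewrite ler_pdivrMr// mul1r ltW.
have k0 : 0 < c / t by rewrite divr_gt0.
have := F1 c c0; have := F0 t t0; rewrite /gap; nra.
Qed.

Lemma loc_integrable_Hardy_step : loc_integrable (Hardy step).
Proof.
exact: loc_integrable_Hardy loc_integrable_step step_nincr _ gap_step_le.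
Qed.

Local Notation Q := (primitive (Hardy step)).

Lemma primitive_Hardy_step_le1 x : 0 < x -> x <= 1 -> Q x = x.
Proof.
move=> x0 x1; rewrite /primitive.
rewrite (@eq_Rintegral _ _ _ _ _ (cst 1)) ?Rintegral_cstoo ?ltW//.
  by rewrite subr0 mul1r.
move=> y; rewrite inE/= in_itv/= => /andP[y0 yx].
by rewrite Hardy_step_le1// (le_trans (ltW yx) x1).
Qed.

Lemma primitive_Hardy_step_ge1 x : 1 <= x -> Q x = 1 + ln x.
Proof.
move=> x1.
have d y : 0 < y -> is_derive y 1 (fun s => Q s - 0 * s - 1 * ln s)
    (Hardy step y - 0 - 1 / y).
  exact: is_derive_primitive_Hardy_subr loc_integrable_step step_nincr
    loc_integrable_Hardy_step 0 1 y.
have d0 y : 1 < y -> Hardy step y - 0 - 1 / y = 0.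
  by move=> y1; rewrite Hardy_step_ge1 ?ltW// subr0 mul1r subrr.
have Q1 := primitive_Hardy_step_le1 ltr01 (lexx 1).
have : Q x - 0 * x - 1 * ln x <= Q 1 - 0 * 1 - 1 * ln 1.
  by apply: (le0_is_derive_le ltr01 x1 d) => y y1 _; rewrite d0.
have : Q 1 - 0 * 1 - 1 * ln 1 <= Q x - 0 * x - 1 * ln x.
  by apply: (ge0_is_derive_le ltr01 x1 d) => y y1 _; rewrite d0.
rewrite ln1 Q1; lra.
Qed.

(** For fixed t the gap is 2 / t times Q(c) - c k with k = Q(t) / t; since
    Q(c) = 1 + ln c for c >= 1, the best c is 1 / k, with value - ln k, and the
    maximum over t is [ln_ratio_le_alpha0]. *)
Lemma gap_Hardy_step_le c t : 0 < c -> c < t ->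
  gap (Hardy step) c t <= alpha0 / 2.
Proof.
move=> c0 ct; have t0 : 0 < t by lra.
have a0 := @alpha0_gt0 R.
have tgap : gap (Hardy step) c t = 2 / t * (Q c - c * (Q t / t)).
  by rewrite /gap !HardyE; field; lra.
have [t1|t1] := leP t 1.
  rewrite tgap !primitive_Hardy_step_le1//; last lra.
  by rewrite divff ?gt_eqF// mulr1 subrr mulr0; lra.
rewrite tgap (primitive_Hardy_step_ge1 (ltW t1)).
have l0 : 0 < ln t by exact: ln_gt0.
set k := (1 + ln t) / t.
have k0 : 0 < k by rewrite divr_gt0//; lra.
have lk : ln k = ln (1 + ln t) - ln t by rewrite /k ln_div ?posrE//; lra.
have Qk : Q c - c * k <= - ln k.
  have [c1|c1] := leP c 1.
    rewrite primitive_Hardy_step_le1//.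
    have k1 : k <= 1.
      by rewrite /k ler_pdivrMr// mul1r; have := ln_sub1 t0; lra.
    have := ln_sub1 k0; nra.
  rewrite (primitive_Hardy_step_ge1 (ltW c1)).
  have := ln_sub1 (mulr_gt0 c0 k0); rewrite lnM ?posrE//; lra.
have := ln_ratio_le_alpha0 (ltW t1).
have -> : (ln t - ln (1 + ln t)) / t = - ln k / t by rewrite lk opprB.
move=> h.
have : 2 / t * (Q c - c * k) <= 2 / t * (- ln k).
  by rewrite ler_pM2l// divr_gt0.
have -> : 2 / t * (- ln k) = 2 * (- ln k / t) by field; lra.
lra.
Qed.

End step_function.

(** * The logarithm *)

Section logarithm.
Context {R : realType}.
Implicit Types (b c t x y z : R).

Local Notation mu := (@lebesgue_measure R).

Definition neglog : R -> R := fun x => - ln x.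

Lemma neglog_nincr : {in `]0, +oo[ &, nonincreasing_fun neglog}.
Proof.
move=> x y; rewrite !in_itv/= !andbT => x0 y0 xy.
by rewrite /neglog lerN2 ler_ln ?posrE.
Qed.

(** The antiderivative of - ln that vanishes at 0. *)
Lemma is_derive_entropy x : 0 < x ->
  is_derive x 1 (fun s : R => s - s * ln s) (- ln x).
Proof.
move=> x0; have nx : x != 0 by rewrite gt_eqF.
have d := is_deriveB (is_derive_id x (1 : R))
  (is_deriveM (is_derive_id x (1 : R)) (is_derive1_ln x0)).
apply: (is_derive_eq d).
by rewrite -![_ *: _]/(_ * _) /=; field.
Qed.

(** The added constant ln b makes the integrand nonnegative, as needed for
    monotone convergence as a tends to 0. *)
Lemma integral_neglog_le a b : 0 < a -> a < b ->
  (\int[mu]_(x in `[a, b]) (ln b - ln x)%:E <= b%:E)%E.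
Proof.
move=> a0 ab; have b0 : 0 < b by lra.
pose U s : R := (s - s * ln s) + ln b * s.
have dU x : 0 < x -> is_derive x 1 U (ln b - ln x).
  move=> x0.
  have d := is_deriveD (is_derive_entropy x0) (is_derive_mulrl (ln b) x).
  by apply: (is_derive_eq d); rewrite addrC.
have cU x : 0 < x -> {for x, continuous U}.
  move=> x0; apply/differentiable_continuous/derivable1_diffP.
  by have [] := dU x x0.
rewrite (@continuous_FTC2 _ (fun x => ln b - ln x) U a b ab).
- rewrite -EFinB lee_fin /U; have : ln a <= ln b by rewrite ler_ln ?posrE// ltW.
  nra.
- apply: continuous_in_subspaceT => x; rewrite inE/= in_itv/= => /andP[ax _].
  have := @continuousB R R R (cst (ln b)) (@ln R) x; apply;
    first exact: cst_continuous.
  by apply: continuous_ln; lra.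
- split.
  + move=> x; rewrite in_itv/= => /andP[ax _].
    by have [] := dU x (lt_trans a0 ax).
  + exact/cvg_at_right_filter/cU.
  + exact/cvg_at_left_filter/cU.
- move=> x; rewrite in_itv/= => /andP[ax _].
  by rewrite derive1E; have [_ ->] := dU x (lt_trans a0 ax).
Qed.

Lemma integrable_neglog b : 0 < b -> mu.-integrable `]0, b] (EFin \o neglog).
Proof.
move=> b0.
pose g x : \bar R := (ln b - ln x)%:E.
have mgE (D : set (measurableTypeR R)) :
    measurable_fun D (EFin \o (fun x : measurableTypeR R => ln b - ln x)).
  apply/measurable_EFinP/measurable_funB => //.
  exact: measurable_funTS (@measurable_ln R).
pose E (n : nat) : set R := `[n.+1%:R^-1, b]%classic.
have E0 n x : E n x -> (0 <= g x)%E.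
  rewrite /E /= in_itv/= lee_fin subr_ge0 => /andP[nx xb].
  by rewrite ler_ln ?posrE// (lt_le_trans _ nx)// invr_gt0 ltr0n.
have ndE : nondecreasing_seq E.
  apply/nondecreasing_seqP => n; apply/subsetPset => x.
  rewrite /E /= !in_itv/= => /andP[nx ->]; rewrite andbT.
  by apply: le_trans nx; rewrite lef_pV2 ?posrE ?ltr0n// ler_nat.
have UE : \bigcup_n E n = `]0, b]%classic.
  apply/seteqP; split=> x /=.
    move=> [n _]; rewrite /E /= !in_itv/= => /andP[nx ->]; rewrite andbT.
    by apply: lt_le_trans nx; rewrite invr_gt0 ltr0n.
  rewrite in_itv/= => /andP[x0 xb].
  exists (Num.truncn x^-1) => //; rewrite /E /= in_itv/= xb andbT.
  rewrite invf_ple ?posrE ?ltr0n// ltW//.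
  exact: truncnS_gt.
have : ((\int[mu]_(x in E i) g x)%E @[i --> \oo] -->
    (\int[mu]_(x in \bigcup_i E i) g x)%E).
  apply: ge0_nondecreasing_set_cvg_integral => // i.
  by rewrite /E; exact: measurable_itv.
rewrite UE => cvg_int.
have le_b : (\int[mu]_(x in `]0%R, b]) g x <= b%:E)%E.
  rewrite -(cvg_lim _ cvg_int)//; apply: lime_le; first exact: cvgP cvg_int.
  apply: nearW => n; have [nb|bn] := ltP n.+1%:R^-1 b.
    by apply: integral_neglog_le => //; rewrite invr_gt0 ltr0n.
  rewrite /E; move: bn; rewrite le_eqVlt => /predU1P[<-|bn].
    by rewrite set_itv1 integral_set1 lee_fin ltW.
  by rewrite set_itv_ge ?bnd_simp -?ltNge// integral_set0 lee_fin ltW.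
have gi : mu.-integrable `]0, b] g.
  apply/integrableP; split; first exact: mgE.
  apply: le_lt_trans (ltry b); apply: le_trans le_b.
  rewrite le_eqVlt; apply/orP; left; apply/eqP; apply: eq_integral => x.
  rewrite inE/= in_itv/= => /andP[x0 xb].
  by rewrite ger0_norm// subr_ge0 ler_ln ?posrE.
rewrite (_ : _ \o _ = g \- (EFin \o cst (ln b)))%E; last first.
  by apply/funext => x /=; rewrite /g /neglog -EFinB; congr EFin; ring.
apply: integrableB => //.
apply/integrableP; split; first exact/measurable_EFinP/measurable_cst.
by rewrite /= integral_cst//= measure_itv ?ltW// -EFinM ltry.
Qed.

Lemma loc_integrable_neglog : loc_integrable neglog.
Proof.
move=> I bI; have [a [b [b0 [b1 [a0 ab eI]]]]] := bounded_itvP bI.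
have [_ _ I0 _] := bI.
have bpos : 0 < b by lra.
have mI : measurable I by rewrite eI; exact: measurable_itv.
apply: integrableS (integrable_neglog bpos) => // x Ix.
have := I0 x Ix; rewrite /= !in_itv/= andbT => ->/=.
by move: Ix; rewrite eI/= in_itv/= => /andP[_]; case: (b1) => //= /ltW.
Qed.

Local Notation P := (primitive neglog).

(** Both sides have the derivative - ln, and both tend to 0 at 0; for the right
    side this is seen along z * z, as - z ln z is bounded. *)
Lemma primitive_neglog x : 0 < x -> P x = x - x * ln x.
Proof.
move=> x0.
have d y : 0 < y -> is_derive y 1 (fun s => P s - (s - s * ln s)) 0.
  move=> y0; have dP : is_derive y 1 P (neglog y).
    apply: is_derive_primitive => //; first exact: loc_integrable_neglog.
    by apply: continuousN; exact: continuous_ln.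
  have := is_deriveB dP (is_derive_entropy y0).
  by rewrite /neglog subrr; apply.
have cst_le y z : 0 < y -> y <= z ->
    P y - (y - y * ln y) = P z - (z - z * ln z).
  move=> y0 yz; apply/le_anti/andP; split.
    exact: (ge0_is_derive_le y0 yz d).
  exact: (le0_is_derive_le y0 yz d).
apply/eqP; rewrite -subr_eq0 -normr_le0; apply/ler_addgt0Pl => e e0.
rewrite addr0; have e3 : 0 < e / 4 by rewrite divr_gt0.
have [d1 d10 Pd] := primitive_near0 loc_integrable_neglog e3.
pose z : R := Num.min (Num.min 1 x) (Num.min d1 (e / 4)) / 2.
have z0 : 0 < z by rewrite divr_gt0// !lt_min ltr01 x0 d10 e3.
have [z1 zx zd ze] : [/\ z <= 1 / 2, z <= x / 2, z <= d1 / 2 & z <= e / 4 / 2].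
  by split; rewrite ler_pM2r// !ge_min ?lexx ?orbT.
have zz0 : 0 < z * z by exact: mulr_gt0.
rewrite -(cst_le (z * z)); [|nra|nra].
have lz : 0 <= - ln z.
  by rewrite oppr_ge0 ln_le0//; lra.
have lz' : - ln z <= z^-1 - 1.
  by rewrite -lnV ?posrE// ln_sub1// invr_gt0.
have lzz : - (z * ln z) <= 1 - z.
  have := ler_wpM2l (ltW z0) lz'.
  by rewrite mulrBr mulfV ?gt_eqF//; lra.
have := Pd (z * z); rewrite lnM ?posrE// !ler_norml.
have zd' : z * z < d1 by nra.
move=> /(_ zd') /andP[h1 h2]; apply/andP; split; nra.
Qed.

Lemma Hardy_neglog x : 0 < x -> Hardy neglog x = neglog x + 1.
Proof.
by move=> x0; rewrite HardyE primitive_neglog// /neglog; field; rewrite gt_eqF.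
Qed.

Lemma gap_neglog c t : 0 < c -> c < t ->
  gap neglog c t = 2 * (c / t) * (ln t - ln c).
Proof.
move=> c0 ct; rewrite /gap !Hardy_neglog//; last lra.
by rewrite /neglog; congr (_ * _); ring.
Qed.

Lemma gap_neglog_le c t : 0 < c -> c < t -> gap neglog c t <= 2.
Proof.
move=> c0 ct; have t0 : 0 < t by lra.
rewrite gap_neglog//.
have -> : ln t - ln c = ln (t / c) by rewrite ln_div ?posrE.
have := ln_sub1 (divr_gt0 t0 c0) => h.
have ct0 : 0 <= c / t by rewrite divr_ge0 ?ltW.
have := ler_wpM2l ct0 h.
have -> : c / t * (t / c - 1) = 1 - c / t by field; lra.
lra.
Qed.

Lemma loc_integrable_Hardy_neglog : loc_integrable (Hardy neglog).
Proof.
exact: loc_integrable_Hardy loc_integrable_neglog neglog_nincr _ gap_neglog_le.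
Qed.

(** The Hardy operator maps - ln to - ln + 1 and fixes constants, and gaps
    ignore constants. *)
Lemma gap_Hardy_neglog c t : 0 < c -> c < t ->
  gap (Hardy neglog) c t = gap neglog c t.
Proof.
have HH x : 0 < x -> Hardy (Hardy neglog) x = Hardy neglog x + 1.
  move=> x0; rewrite [LHS]HardyE.
  have -> : primitive (Hardy neglog) x =
      \int[mu]_(y in `]0, x[) (neglog y - (- 1)).
    apply: eq_Rintegral => y; rewrite inE/= in_itv/= => /andP[y0 _].
    by rewrite Hardy_neglog// opprK.
  rewrite (primitiveB_cst loc_integrable_neglog)// ?ltW// primitive0 HardyE.
  by field; rewrite gt_eqF.
move=> c0 ct; have t0 : 0 < t by lra.
by rewrite /gap !HH//; congr (_ * _); ring.
Qed.

End logarithm.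

(** * Comparison of the norms *)

Section bmo_order.
Context {R : realType}.
Implicit Types (f : R -> R) (c t N : R).

Lemma gap_le_bmo f c t : loc_integrable f ->
  {in `]0, +oo[ &, nonincreasing_fun f} -> 0 < c -> c < t ->
  ((gap f c t)%:E <= bmo f)%E.
Proof.
move=> fi fni c0 ct; case E : (bmo f) => [r| |]; rewrite ?leey//.
  have /(bmo_leP fi fni _) fr : (bmo f <= r%:E)%E by rewrite E.
  by rewrite lee_fin fr.
have : (bmo f <= (gap f c t - 1)%R%:E)%E by rewrite E leNye.
by move=> /(bmo_leP fi fni _)/(_ c t c0 ct) h; exfalso; move: h {E}; lra.
Qed.

Lemma bmo_Hardy_le f : loc_integrable f ->
  {in `]0, +oo[ &, nonincreasing_fun f} -> (bmo (Hardy f) <= bmo f)%E.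
Proof.
move=> fi fni; case E : (bmo f) => [N| |]; rewrite ?leey//.
  have fN : forall c t, 0 < c -> c < t -> gap f c t <= N.
    by apply/(bmo_leP fi fni _); rewrite E.
  have Fi := loc_integrable_Hardy fi fni fN.
  apply/(bmo_leP Fi (Hardy_nonincreasing fi fni) _).
  exact: gap_Hardy_le fi fni Fi N fN.
have := gap_le_bmo fi fni ltr01 (ltr1n R 2); by rewrite E.
Qed.

(** If Hf is not integrable at 0, its norm is infinite and there is nothing to
    prove; otherwise each gap of f is controlled by one gap of Hf. *)
Lemma bmo_Hardy_ge f : loc_integrable f ->
  {in `]0, +oo[ &, nonincreasing_fun f} ->
  (alpha0%:E * bmo f <= bmo (Hardy f))%E.
Proof.
move=> fi fni; have a0 := @alpha0_gt0 R.
have [Fi|nFi] := pselect (loc_integrable (Hardy f)); last first.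
  by rewrite [leRHS]/bmo asboolF// leey.
have Fni := Hardy_nonincreasing fi fni.
case E : (bmo (Hardy f)) => [M| |]; rewrite ?leey//; last first.
  by have := gap_le_bmo Fi Fni ltr01 (ltr1n R 2); rewrite E.
have : (bmo f <= (M / alpha0)%R%:E)%E.
  apply/(bmo_leP fi fni _) => c t c0 ct.
  rewrite ler_pdivlMr// mulrC.
  have [a [b [apos ab /le_trans]]] := alpha0_gap_le fi fni Fi c0 ct; apply.
  by rewrite -lee_fin -E; exact: gap_le_bmo.
by rewrite EFinM lee_pdivlMr// muleC.
Qed.

(** The norm of the indicator is at least 1 / 2 and that of its Hardy
    transform at most alpha0 / 2. *)
Lemma alpha0_optimal c : alpha0 < c ->
  ~ (c%:E * bmo (@step R) <= bmo (Hardy step))%E.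
Proof.
move=> ac; have a0 := @alpha0_gt0 R; have c0 : 0 < c by lra.
have c0E : (0 <= c%:E)%E by rewrite lee_fin ltW.
have Fs : (bmo (Hardy (@step R)) <= (alpha0 / 2)%R%:E)%E.
  apply/(bmo_leP loc_integrable_Hardy_step
    (Hardy_nonincreasing loc_integrable_step step_nincr) _).
  exact: gap_Hardy_step_le.
have s1 : ((2^-1)%R%:E <= bmo (@step R))%E.
  rewrite -gap_step12; apply: gap_le_bmo => //; last by rewrite ltr1n.
  - exact: loc_integrable_step.
  - exact: step_nincr.
move=> h; have := le_trans h Fs.
have : (c%:E * (2^-1)%R%:E <= c%:E * bmo (@step R))%E.
  exact: (lee_wpmul2l c0E s1).
move=> /le_trans /[apply]; rewrite -EFinM lee_fin; lra.
Qed.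

(** The norms of - ln and of its Hardy transform are equal, positive and
    finite. *)
Lemma one_optimal c : c < 1 ->
  ~ (bmo (Hardy (@neglog R)) <= c%:E * bmo neglog)%E.
Proof.
move=> c1.
have li := @loc_integrable_neglog R; have ni := @neglog_nincr R.
have f2 : (bmo (@neglog R) <= 2%:E)%E.
  by apply/(bmo_leP li ni _); exact: gap_neglog_le.
have f1 := gap_le_bmo li ni ltr01 (ltr1n R 2).
move: f1 f2; case E : (bmo neglog) => [m| |]//.
rewrite lee_fin gap_neglog ?ltr01 ?ltr1n// => g1 _.
have m0 : 0 < m.
  by apply: lt_le_trans g1; rewrite ln1 subr0 !mulr_gt0// ln_gt0// ltr1n.
rewrite -EFinM => /(bmo_leP loc_integrable_Hardy_neglog
  (Hardy_nonincreasing li ni) _) Fm.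
have : (bmo (@neglog R) <= (c * m)%R%:E)%E.
  apply/(bmo_leP li ni _) => a b apos ab.
  by rewrite -gap_Hardy_neglog//; exact: Fm.
rewrite E lee_fin {E}; nra.
Qed.

End bmo_order.

Theorem corollary4p3 (R : realType) :
  (forall f : R -> R,
      {in `]0, +oo[ &, nonincreasing_fun f} -> loc_integrable f ->
      (alpha0%:E * bmo f <= bmo (Hardy f))%E /\ (bmo (Hardy f) <= bmo f)%E) /\
  (forall c : R, alpha0 < c ->
      exists f : R -> R,
        [/\ {in `]0, +oo[ &, nonincreasing_fun f}, loc_integrable f &
            ~ (c%:E * bmo f <= bmo (Hardy f))%E]) /\
  (forall c : R, c < 1 ->
      exists f : R -> R,
        [/\ {in `]0, +oo[ &, nonincreasing_fun f}, loc_integrable f &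
            ~ (bmo (Hardy f) <= c%:E * bmo f)%E]).
Proof.
split; [|split].
- by move=> f fni fi; split; [exact: bmo_Hardy_ge|exact: bmo_Hardy_le].
- move=> c ac; exists step; split; last exact: alpha0_optimal.
  + exact: step_nincr.
  + exact: loc_integrable_step.
- move=> c c1; exists neglog; split; last exact: one_optimal.
  + exact: neglog_nincr.
  + exact: loc_integrable_neglog.
Qed.
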